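(* There are absolute constants $c>0$, $n_0$ and $w_0$ such that for every integer $n\ge n_0$, every integer $w\ge w_0$, and every conflict-free deterministic distributed broadcast algorithm for a multiple-access channel with $n$ nodes, there exist a window adversary with individual injection rates, of window size $w$ and with aggregate injection rate smaller than $1$, and an execution of the algorithm against this adversary in which some packet is delayed by at least $c\,n\,w$ rounds.
   Context: Channel. There are $n$ nodes with distinct names $1,\dots,n$; each node knows its name and $n$. Time is divided into synchronous rounds and all nodes start simultaneously. In each round each node performs, in this order: (1) it either transmits one message or pauses, as determined by its state; (2) it receives feedback from the channel; (3) packets may be injected into it; (4) it makes a deterministic state transition determined by its state at the end of the previous round, the packets injected into it in this round, and the feedback. A message may contain at most one packet (from the transmitting node's queue) and possibly control bits. If exactly one node transmits in a round, its message is heard by all nodes in this round; if no node transmits, the feedback is silence; if two or more nodes transmit, a collision occurs and nothing is heard. Each node keeps its packets in a private queue of unbounded capacity; injected packets are enqueued in the round of injection, and a packet is discarded once it is heard. Packets are abstract markers whose contents do not affect the algorithm. The algorithm does not know any parameter of the adversary. Conflict-free. An algorithm is conflict-free if in any execution at most one node transmits in any round; for such algorithms the channel is assumed to be without collision detection (silence and collision give the same feedback). Adversary. A window adversary with individual injection rates is given by a positive integer window size $w$ and non-negative integer shares $s_1,\dots,s_n$ with $\sum_{i=1}^n s_i\le w$; in any interval of $w$ contiguous rounds it may inject at most $s_i$ packets into node $i$, for each $i$. Its aggregate injection rate is $\rho=(\sum_{i=1}^n s_i)/w$. Delay. The delay of a packet is the number of rounds it spends waiting in a queue (infinite if it is never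 heard). *)

(* Defs.v *)
(* MathComp / MathComp-Analysis *)
From mathcomp Require Import all_boot all_order all_algebra.
From mathcomp Require Import all_classical all_reals all_analysis.

Set Implicit Arguments.
Unset Strict Implicit.
Unset Printing Implicit Defensive.

Import Order.TTheory GRing.Theory Num.Theory.

Local Open Scope ring_scope.

(* The name of a node and the number n of nodes are available to the node
   through its initial state, [alg_init].

   [alg_action s = None] means "pause".  [alg_action s = Some (k, b)] means
   "transmit a message with control bits b"; when [k = Some j], the message also
   carries the packet at position j (from 0, in order of arrival) of the node's
   own queue, provided the queue is that long.

   In [alg_next s m fb], m is the number of packets just injected into the node
   and fb the feedback from the channel: [None] if nothing is heard (silence and
   collision are not distinguished), [Some (p, b)] if a message with control
   bits b is heard, p telling whether it carries a packet. *)
Record algorithm (n : nat) := Algorithm {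
  alg_state : Type;
  alg_init : 'I_n -> alg_state;
  alg_action : alg_state -> option (option nat * seq bool);
  alg_next : alg_state -> nat -> option (bool * seq bool) -> alg_state }.

Record window_adversary (n : nat) := WindowAdversary {
  adv_window : nat;
  adv_share : 'I_n -> nat;
  adv_window_gt0 : (0 < adv_window)%N;
  adv_share_le : (\sum_(i < n) adv_share i <= adv_window)%N }.

Definition aggregate_rate (n : nat) (adv : window_adversary n) : rat :=
  (\sum_(i < n) adv_share adv i)%N%:R / (adv_window adv)%:R.

(* [inj r i] is the number of packets injected into node i in round r; rounds
   are numbered 0, 1, 2, ... *)
Definition injection_pattern (n : nat) := nat -> 'I_n -> nat.

Definition allowed (n : nat) (adv : window_adversary n)
    (inj : injection_pattern n) : Prop :=
  forall (t : nat) (i : 'I_n),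
    (\sum_(t <= r < t + adv_window adv) inj r i <= adv_share adv i)%N.

(* (i, r, k) is the k-th packet (from 0) injected into node i in round r. *)
Definition packet (n : nat) := ('I_n * nat * nat)%type.

Definition injected (n : nat) (inj : injection_pattern n) (p : packet n) : bool :=
  let: (i, r, k) := p in (k < inj r i)%N.

Definition message (n : nat) := (option (packet n) * seq bool)%type.

Record config (n : nat) (A : algorithm n) := Config {
  node_state : 'I_n -> alg_state A;
  node_queue : 'I_n -> seq (packet n) }.

Section Execution.
Variables (n : nat) (A : algorithm n).

Definition outgoing (C : config A) (i : 'I_n) : option (message n) :=
  if alg_action (node_state C i) is Some (k, b)
  then Some (obind (onth (node_queue C i)) k, b)
  else None.

Definition transmitters (C : config A) : {set 'I_n} :=
  [set i | isSome (outgoing C i)].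

Definition heard (C : config A) : option (message n) :=
  if pmap (outgoing C) (enum 'I_n) is [:: m] then Some m else None.

Definition feedback (C : config A) : option (bool * seq bool) :=
  omap (fun m : message n => (isSome m.1, m.2)) (heard C).

Definition discard (C : config A) (q : seq (packet n)) : seq (packet n) :=
  if heard C is Some (Some p, _) then rem p q else q.

Variable inj : injection_pattern n.

Definition step (r : nat) (C : config A) : config A :=
  Config
    (fun i => alg_next (node_state C i) (inj r i) (feedback C))
    (fun i => discard C (node_queue C i) ++ [seq (i, r, k) | k <- iota 0 (inj r i)]).

(* [execution r] is the configuration at the start of round r. *)
Fixpoint execution (r : nat) : config A :=
  if r is r'.+1 then step r' (execution r')
  else Config (@alg_init n A) (fun=> [::]).

End Execution.

Definition conflict_free (n : nat) (A : algorithm n) : Prop :=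
  forall (adv : window_adversary n) (inj : injection_pattern n),
    allowed adv inj ->
    forall r : nat, (#|transmitters (execution A inj r)| <= 1)%N.

(* The number of rounds at the start of which p is in the queue of its node; a
   packet injected in round t and heard in round t' has delay t' - t. *)
Definition delay (R : realType) (n : nat) (A : algorithm n)
    (inj : injection_pattern n) (p : packet n) : \bar R :=
  (\sum_(0 <= r <oo)
     (p \in node_queue (execution A inj r) p.1.1)%:R%:E)%E.

(* Main.v *)
(* Load one node i0 with bursts of w - 2 packets every w rounds.  If no packet of
   this execution waits long, the queue of i0 stays bounded, so i0 is silent in
   only about 2 rounds out of w.  Injecting one more packet into a node j at round
   s first changes the behaviour of j in a round where i0 is silent, and these
   rounds are distinct for distinct j, for otherwise two such injections made
   together would cause a conflict.  As fewer than n - 1 rounds are silent in some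
   window of about n w / 2 rounds, some j keeps its extra packet during all of it.
   Injecting in both j and j' makes the shares sum up to w, which is why i0 gets
   w - 2: conflict-freedom only needs the rate to be at most 1. *)
Require Import Defs.
From mathcomp Require Import all_boot all_order all_algebra.
From mathcomp Require Import all_classical all_reals all_analysis.
From mathcomp Require Import zify.

Set Implicit Arguments.
Unset Strict Implicit.
Unset Printing Implicit Defensive.

Import Order.TTheory GRing.Theory Num.Theory.

Local Open Scope ring_scope.

(** * Queues, and what a node can learn from the channel *)

Section Executions.
Local Open Scope nat_scope.
Variables (n : nat) (A : algorithm n).
Implicit Types (inj : injection_pattern n) (i j : 'I_n) (p : packet n).

Lemma heard_outgoing (C : config A) (m : message n) :
  heard C = Some m -> exists i, outgoing C i = Some m.
Proof.
rewrite /heard; case E: (pmap _ _) => [|m' [|]] // -[mm'].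
have: m \in pmap (outgoing C) (enum 'I_n) by rewrite E mm' inE.
by rewrite mem_pmap => /mapP[i _ ->]; exists i.
Qed.

Lemma mem_queue inj t i p : p \in node_queue (execution A inj t) i ->
  [/\ p.1.1 = i, p.1.2 < t & p.2 < inj p.1.2 i].
Proof.
elim: t => [//|t IH] /=; rewrite mem_cat => /orP[|/mapP[k]].
  rewrite /discard => pq; have /IH[-> lt_t ->] :
      p \in node_queue (execution A inj t) i.
    by move: pq; case: heard => [[[q|] b]|] // /mem_rem.
  by split=> //; apply: ltnW.
by rewrite mem_iota => /andP[_ ltk] ->.
Qed.

Lemma queue_uniq inj t i : uniq (node_queue (execution A inj t) i).
Proof.
elim: t => [//|t IH] /=; rewrite cat_uniq; apply/and3P; split.
- by rewrite /discard; case: heard => [[[q|] b]|] //; exact: rem_uniq.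
- apply/hasPn => _ /mapP[k _ ->]; apply/negP; rewrite /discard => pq.
  have /mem_queue[_ /=] : (i, t, k) \in node_queue (execution A inj t) i.
    by move: pq; case: heard => [[[q|] b]|] // /mem_rem.
  by rewrite ltnn.
- by rewrite map_inj_uniq ?iota_uniq // => k l [].
Qed.

(** A packet enters its queue only in its injection round, so it cannot reappear after being
    discarded. *)
Lemma queue_persistent inj t u i p : p.1.2 < u -> u <= t ->
  p \in node_queue (execution A inj t) i ->
  p \in node_queue (execution A inj u) i.
Proof.
move=> ltpu; elim: t => [|t IH]; first by rewrite leqn0 => /eqP->.
rewrite leq_eqVlt => /predU1P[-> //|]; rewrite ltnS => leut /=.
rewrite mem_cat => /orP[|/mapP[k _ pE]]; last first.
  by move: ltpu; rewrite pE /= ltnNge leut.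
rewrite /discard => pq; apply: IH => //.
by move: pq; case: heard => [[[q|] b]|] // /mem_rem.
Qed.

Lemma transmitter_unique inj t i j :
  #|transmitters (execution A inj t)| <= 1 ->
  outgoing (execution A inj t) i -> outgoing (execution A inj t) j -> i = j.
Proof. by move=> /card_le1_eqP le1 oi oj; apply: le1; rewrite inE. Qed.

(** The other nodes influence a node only through the feedback, so its local history is a function
    of what was heard and of its own injections. *)
Lemma execution_local inj inj' t i :
    (forall u, u < t ->
      heard (execution A inj u) = heard (execution A inj' u)) ->
    (forall u, u < t -> inj u i = inj' u i) ->
  node_state (execution A inj t) i = node_state (execution A inj' t) i /\
  node_queue (execution A inj t) i = node_queue (execution A inj' t) i.
Proof.
elim: t => [//|t IH] hE iE /=.
have [|//|-> ->] := IH; first by move=> u ltu; apply/hE/ltnW.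
  by move=> u ltu; apply/iE/ltnW.
by rewrite /feedback /discard hE // iE.
Qed.

Lemma outgoing_local inj inj' t i :
    (forall u, u < t ->
      heard (execution A inj u) = heard (execution A inj' u)) ->
    (forall u, u < t -> inj u i = inj' u i) ->
  outgoing (execution A inj t) i = outgoing (execution A inj' t) i.
Proof.
by move=> hE iE; rewrite /outgoing; have [-> ->] := execution_local hE iE.
Qed.

(** Strong induction on rounds: messages in a round may be compared under the assumption that all
    earlier rounds sounded alike, which is the form in which [outgoing_local] applies. *)
Lemma eq_heard inj inj' t :
  (forall u, u < t ->
    (forall v, v < u ->
      heard (execution A inj v) = heard (execution A inj' v)) ->
    forall i, outgoing (execution A inj u) i = outgoing (execution A inj' u) i) ->
  forall u, u < t -> heard (execution A inj u) = heard (execution A inj' u).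
Proof.
move=> H; elim/ltn_ind => u IH ltu; rewrite /heard.
rewrite (eq_pmap (f2 := outgoing (execution A inj' u))) // => i.
by apply: H => // v ltv; apply: IH => //; apply: ltn_trans ltu.
Qed.

End Executions.

Lemma delay_ge (R : realType) (n : nat) (A : algorithm n)
    (inj : injection_pattern n) (p : packet n) (a D : nat) :
    (forall r : nat, (a < r <= a + D)%N ->
      p \in node_queue (execution A inj r) p.1.1) ->
  (D%:R%:E <= delay R A inj p)%E.
Proof.
move=> H; rewrite /delay.
apply: le_trans (@nneseries_lim_ge R _ xpredT 0%N (a.+1 + D)%N _); last first.
  by move=> k _ _; rewrite lee_fin ler0n.
rewrite sumEFin lee_fin -natr_sum ler_nat.
rewrite (big_cat_nat (n := a.+1)) ?leq_addr //=.
apply: leq_trans (leq_addl _ _).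
rewrite big_nat (eq_bigr (fun=> 1%N)) => [|r /andP[ar rD]].
  by rewrite -big_nat sum_nat_const_nat addKn muln1.
by rewrite H // ar -ltnS -addSn.
Qed.

(** * Bursts at one node plus single extra packets *)

Section Adversary.
Local Open Scope nat_scope.

Lemma sum_periodic (f : nat -> nat) w t : (forall r, f (r + w) = f r) ->
  \sum_(t <= r < t + w) f r = \sum_(0 <= r < w) f r.
Proof.
move=> fE; elim: t => [//|t <-]; apply: (@addnI (f t)).
by rewrite addSn -big_ltn ?ltnS ?leq_addr// big_nat_recr ?leq_addr//= fE addnC.
Qed.

Lemma sum_periods (f : nat -> nat) w q : (forall r, f (r + w) = f r) ->
  \sum_(0 <= r < q * w) f r = q * \sum_(0 <= r < w) f r.
Proof.
move=> fE; elim: q => [|q IH]; first by rewrite !mul0n big_geq.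
rewrite mulSn addnC (big_cat_nat (n := q * w)) ?leq_addr //= IH.
by rewrite sum_periodic // mulSn addnC.
Qed.

Definition burst w r := (w %| r) * (w - 2).

Lemma burst_periodic w r : burst w (r + w) = burst w r.
Proof. by rewrite /burst dvdn_addl. Qed.

Lemma sum_burst w : \sum_(0 <= r < w) burst w r = w - 2.
Proof.
case: w => [|w]; first by rewrite big_geq.
rewrite big_ltn // big_nat big1 ?addn0 ?/burst ?dvdn0 ?mul1n // => r /andP[r0 rw].
by rewrite gtnNdvd.
Qed.

Variables (n w : nat) (i0 : 'I_n).

(** The empty [X] gives the reference execution, a singleton tests one node, and a pair serves to
    provoke a conflict. *)
Definition probe_pattern (s : nat) (X : {set 'I_n}) : injection_pattern n :=
  fun r i => (i == i0) * burst w r + ((r == s) && (i \in X)).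

Definition probe_share (X : {set 'I_n}) (i : 'I_n) :=
  (i == i0) * (w - 2) + (i \in X).

Lemma sum_probe_share X : \sum_(i < n) probe_share X i = w - 2 + #|X|.
Proof.
rewrite big_split /= (bigD1 i0) //= eqxx mul1n big1 ?addn0 => [|i /negbTE-> //].
by rewrite -sum1_card [in RHS]big_mkcond.
Qed.

Hypothesis w2 : 1 < w.

Lemma probe_share_le (X : {set 'I_n}) : #|X| <= 2 ->
  \sum_(i < n) probe_share X i <= w.
Proof. by rewrite sum_probe_share; move: w2; lia. Qed.

Definition probe_adversary (X : {set 'I_n}) (X2 : #|X| <= 2) :
  window_adversary n :=
  WindowAdversary (ltnW w2) (probe_share_le X2).

Lemma probe_allowed s (X : {set 'I_n}) (X2 : #|X| <= 2) :
  allowed (probe_adversary X2) (probe_pattern s X).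
Proof.
move=> t i /=; rewrite /probe_pattern /probe_share big_split /=.
apply: leq_add.
  by rewrite -big_distrr /= (sum_periodic _ (burst_periodic w)) sum_burst.
rewrite -[leqRHS]mul1n; case: (i \in X); last by rewrite big1 // => r _; rewrite andbF.
under eq_bigr do rewrite andbT.
have [/andP[ts stw]|ns] := boolP (t <= s < t + w).
  rewrite (bigD1_seq s) ?mem_index_iota ?ts ?iota_uniq //= eqxx big1 // => r.
  by move=> /negbTE->.
rewrite big_nat big1 // => r; case: eqP => [->|//].
by rewrite (negbTE ns).
Qed.

Lemma probe_rate (X : {set 'I_n}) (X2 : #|X| <= 2) : #|X| <= 1 ->
  (aggregate_rate (probe_adversary X2) < 1)%R.
Proof.
move=> X1; rewrite /aggregate_rate ltr_pdivrMr ?ltr0n ?(ltnW w2) // mul1r ltr_nat.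
by rewrite /= sum_probe_share; move: w2; lia.
Qed.

End Adversary.

(** * When and how an extra packet is noticed *)

Section Probes.
Local Open Scope nat_scope.
Variables (n w : nat) (i0 : 'I_n) (A : algorithm n).
Hypotheses (w2 : 1 < w) (cfA : conflict_free A).

Local Notation probe s X := (execution A (probe_pattern w i0 s X)).
Local Notation base := (probe 0 finset.set0).

Lemma probe_pattern0 s :
  probe_pattern w i0 s finset.set0 = probe_pattern w i0 0 finset.set0.
Proof.
apply/funext => r; apply/funext => i.
by rewrite /probe_pattern !inE !andbF.
Qed.

Lemma probe_transmitter_unique s (X : {set 'I_n}) t i j : #|X| <= 2 ->
  outgoing (probe s X t) i -> outgoing (probe s X t) j -> i = j.
Proof.
by move=> X2; apply/transmitter_unique/cfA; exact: (probe_allowed i0 w2 s X2).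
Qed.

(** Only [j] itself is compared: the other nodes notice nothing before [j] behaves differently. *)
Definition deviates s j t :=
  outgoing (probe s [set j] t) j != outgoing (base t) j.

(** Injection follows transmission within a round, so a packet injected in round [s] influences
    actions from round [s.+1] on at the earliest. *)
Lemma deviates_after s j t : deviates s j t -> s < t.
Proof.
apply: contraNT; rewrite -leqNgt => les.
have E u i : u < s ->
    probe_pattern w i0 s [set j] u i = probe_pattern w i0 0 finset.set0 u i.
  by move=> ltu; rewrite /probe_pattern !inE (ltn_eqF ltu) andbF.
apply/eqP/outgoing_local => [|u ut]; last by apply/E/leq_trans/les.
apply: eq_heard => u ut hE i; apply: outgoing_local => // v vu.
by apply/E/(ltn_trans vu)/leq_trans/les.
Qed.

Lemma heard_probe1 s j t : (forall u, u < t -> ~~ deviates s j u) ->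
  forall u, u < t -> heard (probe s [set j] u) = heard (base u).
Proof.
move=> nd; apply: eq_heard => u ut hE i.
have [->|ij] := eqVneq i j; first by move/negPn/eqP: (nd u ut).
apply: outgoing_local => // v vu.
by rewrite /probe_pattern !inE (negbTE ij) !andbF.
Qed.

(** Extra packets do not interact before one is noticed: while the channel sounds as in [base], a
    node of [X] has the same local history as when it alone is probed, and any other node the same
    as in [base]. *)
Lemma heard_probe s (X : {set 'I_n}) t :
    (forall j, j \in X -> forall u, u < t -> ~~ deviates s j u) ->
  forall u, u < t -> heard (probe s X u) = heard (base u).
Proof.
move=> nd; apply: eq_heard => u ut hE i.
have [iX|iX] := boolP (i \in X); last first.
  apply: outgoing_local => // v vu.
  by rewrite /probe_pattern !inE (negbTE iX) !andbF.
move/negPn/eqP: (nd i iX u ut) => <-; apply: outgoing_local => v vu.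
  rewrite hE // (@heard_probe1 s i u) // => x xu.
  by apply: nd => //; apply: ltn_trans ut.
by rewrite /probe_pattern !inE iX eqxx.
Qed.

Lemma outgoing_probe s (X : {set 'I_n}) t i :
    (forall j, j \in X -> forall u, u < t -> ~~ deviates s j u) ->
  outgoing (probe s X t) i =
  outgoing (if i \in X then probe s [set i] t else base t) i.
Proof.
move=> nd; have hE := heard_probe nd.
have [iX|iX] := boolP (i \in X); apply: outgoing_local => u ut.
- by rewrite hE // (heard_probe1 (nd i iX)).
- by rewrite /probe_pattern !inE iX eqxx.
- exact: hE.
- by rewrite /probe_pattern !inE (negbTE iX) !andbF.
Qed.

Definition first_deviation s j t :=
  deviates s j t /\ forall u, u < t -> ~~ deviates s j u.

Lemma deviates_outgoing s j t : deviates s j t ->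
  outgoing (probe s [set j] t) j \/ outgoing (base t) j.
Proof. by rewrite /deviates; case: (outgoing (base t) j); case: outgoing; auto. Qed.

(** The deviating [j] transmits in the probe or in [base], and [i] still acts alike in both, so a
    transmission of [i] would conflict. With [i = i0] this puts deviations into idle rounds of [i0];
    with [i] another node deviating in round [t], it shows that [i] starts transmitting rather than
    falls silent. *)
Lemma first_deviation_idle s j i t : i != j ->
  first_deviation s j t -> ~~ outgoing (base t) i.
Proof.
move=> ij [dj nd]; apply/negP => oi; case/negP: ij.
case: (deviates_outgoing dj) => oj; apply/eqP.
  apply: (@probe_transmitter_unique s [set j] t); rewrite ?cards1 //.
  rewrite outgoing_probe ?inE => [|k]; last by rewrite inE => /eqP->.
  by case: eqP oj => [->|].
by apply: (@probe_transmitter_unique 0 finset.set0 t); rewrite ?cards0.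
Qed.

(* If both first deviations were in the same round then both nodes would
   transmit in that round when each of them gets its extra packet. *)
Lemma first_deviation_inj s j k t :
  first_deviation s j t -> first_deviation s k t -> j = k.
Proof.
move=> dj dk; have [//|jk] := eqVneq j k.
have out i i' : i != i' -> first_deviation s i t -> first_deviation s i' t ->
    outgoing (probe s [set i] t) i.
  move=> ii' di di'; case: (deviates_outgoing di.1) => // oi.
  by case/negP: (first_deviation_idle ii' di').
have nd i : i \in [set j; k] -> forall u, u < t -> ~~ deviates s i u.
  by rewrite !inE => /orP[] /eqP->; [exact: dj.2 | exact: dk.2].
apply: (@probe_transmitter_unique s [set j; k] t); rewrite ?cards2 ?jk //.
  by rewrite outgoing_probe // !inE eqxx; apply: out dj dk.
by rewrite outgoing_probe // !inE eqxx orbT; apply: out dk dj; rewrite eq_sym.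
Qed.

(** * Waiting packets and the idle rounds of [i0] *)

Lemma heard_packet_base t (p : packet n) b :
  heard (base t) = Some (Some p, b) -> p.1.1 = i0 /\ outgoing (base t) i0.
Proof.
case/heard_outgoing => i oi; have pq : p \in node_queue (base t) i.
  move: oi; rewrite /outgoing; case: alg_action => [[[k|] b'] /=|] // [E _].
  by apply/onthP; exists k.
have [-> _] := mem_queue pq; rewrite /probe_pattern !inE andbF addn0.
by case: eqP => [ii0 _|//]; split; last by rewrite -[X in outgoing _ X]ii0 oi.
Qed.

(** Until [j] deviates the channel sounds as in [base], where every packet heard belongs to [i0]. *)
Lemma probe_waits s j t : j != i0 -> (forall u, u < t -> ~~ deviates s j u) ->
  forall r, s < r <= t -> (j, s, 0) \in node_queue (probe s [set j] r) j.
Proof.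
move=> ji0 nd; elim=> [//|r IH] /andP[sr rt] /=; rewrite mem_cat.
have [->|nsr] := eqVneq s r.
  by rewrite /probe_pattern (negbTE ji0) !inE !eqxx inE eqxx orbT.
rewrite /discard (heard_probe1 nd) //; apply/orP; left.
have {}IH : (j, s, 0) \in node_queue (probe s [set j] r) j.
  by apply: IH; rewrite ltn_neqAle nsr -ltnS sr ltnW.
case E: heard => [[[p|] b]|] //; have [pi0 _] := heard_packet_base E.
by apply: rem_mem => //; apply: contraNneq ji0 => jE; rewrite -pi0 -jE.
Qed.

(** In each round the queue of [i0] loses at most one packet, and only if [i0] transmits. *)
Lemma queue_balance t :
  \sum_(0 <= r < t) burst w r <=
  size (node_queue (base t) i0) + \sum_(0 <= r < t) isSome (outgoing (base r) i0).
Proof.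
elim: t => [|t IH]; first by rewrite !big_geq.
rewrite !big_nat_recr //= size_cat size_map size_iota.
have -> : probe_pattern w i0 0 finset.set0 t i0 = burst w t.
  by rewrite /probe_pattern eqxx !inE andbF addn0 mul1n.
suff: size (node_queue (base t) i0) <=
    size (discard (base t) (node_queue (base t) i0)) + isSome (outgoing (base t) i0).
  by move: IH; lia.
rewrite /discard; case E: heard => [[[p|] b]|]; rewrite ?leq_addr //.
have [_ ->] := heard_packet_base E.
have [pq|pq] := boolP (p \in node_queue (base t) i0); last by rewrite rem_id ?leq_addr.
by rewrite size_rem // addn1 leqSpred.
Qed.

(** All queued packets were injected within the last [D] rounds, at most [w] per round. This crude
    bound suffices, as the number of blocks in the count below is chosen to exceed it. *)
Lemma queue_size_le D t :
    (forall p, p \in node_queue (base t) i0 -> t <= p.1.2 + D) ->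
  size (node_queue (base t) i0) <= D * w.
Proof.
move=> le_delay.
pose l := [seq (i0, r, k) | r <- iota (t - D) D, k <- iota 0 w].
have <- : size l = D * w by rewrite size_allpairs !size_iota.
apply: uniq_leq_size; [exact: queue_uniq | move=> [[i r] k] pq].
have /= [ii0 rt] := mem_queue pq; have /= tr := le_delay _ pq.
rewrite /probe_pattern ii0 eqxx !inE andbF addn0 mul1n /burst => kw.
apply/allpairsP; exists (r, k); split=> //=; rewrite mem_iota; first by lia.
by move: kw; case: (w %| r); lia.
Qed.

(** Otherwise every block of [m * w] rounds would contain [n.-1] idle rounds of [i0], more than the
    [2 * m] that the load leaves on average. *)
Lemma exists_undetected_probe m : 2 * m + 2 <= n ->
    (forall t p, p \in node_queue (base t) i0 -> t <= p.1.2 + m * w) ->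
  exists s j, j != i0 /\ forall u, u < s + m * w + 1 -> ~~ deviates s j u.
Proof.
move=> mn le_delay; set M := m * w.
have [//|none] := pselect (exists s j, j != i0 /\
  forall u, u < s + M + 1 -> ~~ deviates s j u).
exfalso.
(* For [j = i0] the round [T] is a dummy, so that [choice] yields a total function. *)
have dev s j : exists T, j != i0 -> T <= s + M /\ first_deviation s j T.
  have [->|ji0] := eqVneq j i0; first by exists 0 => /negP[].
  have [ex|nex] := pselect (exists u, (u <= s + M) && deviates s j u); last first.
    case: none; exists s, j; split=> // u us; apply/negP => du.
    by case: nex; exists u; rewrite du andbT; move: us; rewrite addn1 ltnS.
  case: (ex_minnP ex) => T /andP[Ts dT] Tmin; exists T => _.
  split=> //; split=> // u uT.
  apply/negP => du; have := Tmin u.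
  by rewrite du (leq_trans (ltnW uT) Ts) => /(_ isT); rewrite leqNgt uT.
pose idle r := ~~ outgoing (base r) i0.
have block s : n.-1 <= \sum_(s.+1 <= r < s.+1 + M) idle r.
  have [T TP] := choice (dev s).
  have -> : \sum_(s.+1 <= r < s.+1 + M) idle r =
      size [seq r <- index_iota s.+1 (s.+1 + M) | idle r].
    rewrite size_filter -sum1_count [in RHS]big_mkcond.
    by apply: eq_bigr => r _; case: idle.
  have <- : size [seq T j | j <- enum (predC1 i0)] = n.-1.
    by rewrite size_map -cardE cardC1 card_ord.
  apply: uniq_leq_size.
    rewrite map_inj_in_uniq ?enum_uniq // => j k; rewrite !mem_enum !inE => ji ki jk.
    apply: (@first_deviation_inj s j k (T j)); first exact: (TP j ji).2.
    by rewrite jk; exact: (TP k ki).2.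
  move=> _ /mapP[j + ->]; rewrite mem_enum !inE => ji.
  have [Ts dT] := TP j ji; rewrite mem_filter mem_index_iota.
  rewrite (deviates_after dT.1) addSn ltnS Ts !andbT /idle.
  by apply: first_deviation_idle dT; rewrite eq_sym.
(* The block probed in round [s] starts in [s.+1], so consecutive blocks cover the rounds from 1 to
   [K * M]. *)
have blocks K : K * n.-1 <= \sum_(0 <= r < (K * M).+1) idle r.
  elim: K => [//|K IH]; rewrite mulSn addnC.
  rewrite (big_cat_nat (n := (K * M).+1)) //=; last by rewrite ltnS mulSn leq_addl.
  by apply: leq_add IH _; rewrite mulSn addnC -addSn.
have total t : \sum_(0 <= r < t) isSome (outgoing (base r) i0) +
    \sum_(0 <= r < t) idle r = t.
  rewrite -big_split /= (eq_bigr (fun=> 1)) => [|r _]; last by rewrite /idle; case: outgoing.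
  by rewrite sum_nat_const_nat subn0 muln1.
(* Load and queue bound allow at most [2 * K * m + M * w + 1] idle rounds, while the blocks force at
   least [K * (2 * m + 1)]; this is the least [K] for which the two contradict each other. *)
pose K := M * w + 2.
have inj_le : K * m * (w - 2) <= \sum_(0 <= r < (K * M).+1) burst w r.
  rewrite big_nat_recr //= /M mulnA (sum_periods _ (burst_periodic w)).
  by rewrite sum_burst leq_addr.
have := queue_balance (K * M).+1; have := total (K * M).+1.
have := queue_size_le (le_delay (K * M).+1); have := blocks K; move: inj_le.
have KM : K * M = K * m * (w - 2) + 2 * (K * m).
  by rewrite /M mulnA -[in LHS](subnK w2) mulnDr [2 * _]mulnC.
have Kn : K * (2 * m + 1) <= K * n.-1 by rewrite leq_mul2l; apply/orP; right; lia.
by move: KM Kn; rewrite mulnDr muln1 mulnCA /K; lia.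
Qed.

End Probes.

(** * The delayed packet: from a burst or from a probe *)

Theorem theorem4 (R : realType) :
  exists (c : R) (n0 w0 : nat), 0 < c /\
    forall n w : nat, (n0 <= n)%N -> (w0 <= w)%N ->
    forall A : algorithm n, conflict_free A ->
    exists adv : window_adversary n,
      [/\ adv_window adv = w, aggregate_rate adv < 1 &
        exists2 inj : injection_pattern n, allowed adv inj &
        exists2 p : packet n, injected inj p &
          ((c * n%:R * w%:R)%:E <= delay R A inj p)%E].
Proof.
(* For [m = (n - 2)./2] the bound [n <= 8 * m] holds from [n = 4] on; [2 <= w] keeps [w - 2] from
   being truncated. *)
exists 8%:R^-1, 4%N, 2%N; split=> [|n w n4 w2 A cfA]; first by rewrite invr_gt0 ltr0n.
have i0 : 'I_n by exists 0%N; apply: leq_trans n4.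
pose m := (n - 2)./2.
have mn : (2 * m + 2 <= n)%N by rewrite /m; lia.
have cM : ((8%:R^-1 * n%:R * w%:R : R)%:E <= (m * w)%:R%:E)%E.
  rewrite lee_fin -mulrA -natrM mulrC ler_pdivrMr ?ltr0n // -natrM ler_nat.
  by rewrite mulnAC leq_mul2r; apply/orP; right; rewrite /m; lia.
have long_wait s (X : {set 'I_n}) (p : packet n) : (#|X| <= 1)%N ->
    injected (probe_pattern w i0 s X) p ->
    (forall r, (p.1.2 < r <= p.1.2 + m * w)%N ->
      p \in node_queue (execution A (probe_pattern w i0 s X) r) p.1.1) ->
    exists adv : window_adversary n,
      [/\ adv_window adv = w, aggregate_rate adv < 1 &
        exists2 inj : injection_pattern n, allowed adv inj &
        exists2 p : packet n, injected inj p &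
          ((8%:R^-1 * n%:R * w%:R)%:E <= delay R A inj p)%E].
  move=> X1 pinj pq; exists (probe_adversary i0 w2 (leqW X1)); split=> //.
    exact: probe_rate.
  exists (probe_pattern w i0 s X); first exact: probe_allowed.
  by exists p => //; apply: le_trans cM _; apply: delay_ge pq.
(* Either some packet of [i0] waits long enough without any extra injection, or the queue of [i0]
   stays bounded and an undetected probe exists. *)
have [[t [p [pq pt]]]|nlong] := pselect (exists t p,
    p \in node_queue (execution A (probe_pattern w i0 0 finset.set0) t) i0 /\
    (p.1.2 + m * w < t)%N).
  have [pi0 _ pinj] := mem_queue pq.
  apply: (long_wait 0%N finset.set0 p); first by rewrite cards0.
    by move: pinj; rewrite -pi0; case: p {pq pt pi0} => [[i r] k].
  move=> r /andP[pr rp]; rewrite pi0; apply: queue_persistent pq => //.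
  by apply: leq_trans rp (ltnW pt).
have [t p pq|s [j [ji0 nd]]] := @exists_undetected_probe n w i0 A w2 cfA m mn.
  by rewrite leqNgt; apply/negP => tp; apply: nlong; exists t, p.
apply: (long_wait s [set j] (j, s, 0%N)); first by rewrite cards1.
  by rewrite /= /probe_pattern !inE !eqxx addn1.
move=> r /= sr; apply: (probe_waits ji0 nd).
by case/andP: sr => -> rs; rewrite addn1 leqW.
Qed.
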